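(* Suppose $n>1$, $1\le p<n$ and $\frac1p-\frac1q=\frac1n$. Then the weighted Sobolev inequality $$\|f\|_{L^q(w^q)}\le c\,[w]_{A_{p,q}}^{1/n'}\,\|\nabla f\|_{L^p(w^p)}$$ is sharp since the exponent $1/n'$ cannot be replaced by any smaller power.
   Context: $n'=n/(n-1)$, $p'=p/(p-1)$, and $\|f\|_{L^p(w)}=(\int_{\mathbb{R}^n}|f|^pw\,dx)^{1/p}$. A weight is a non-negative measurable function on $\mathbb{R}^n$ that is positive on a set of positive measure. For $p>1$, a weight $w$ belongs to $A_{p,q}$ if $$[w]_{A_{p,q}}=\sup_Q\Big(\frac1{|Q|}\int_Qw^q\,dx\Big)\Big(\frac1{|Q|}\int_Qw^{-p'}\,dx\Big)^{q/p'}<\infty,$$ the supremum being over all cubes $Q$ with sides parallel to the axes; for $p=1$ the second factor is interpreted as $\operatorname{ess\,sup}_{Q}w^{-q}$. The inequality is for weights $w\in A_{p,q}$ and functions $f$ on $\mathbb{R}^n$ regular (smooth) enough for the gradient to make sense, with no compact support imposed; it is a previously known result that it holds with exponent $1/n'$ and a constant $c$ independent of $w$ and $f$. *)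

(* Defs.v *)
From HB Require Import structures.
From mathcomp Require Import all_boot all_order all_algebra.
From mathcomp Require Import all_classical all_reals all_analysis ess_sup_inf.

Set Implicit Arguments.
Unset Strict Implicit.
Unset Printing Implicit Defensive.

Import Order.TTheory GRing.Theory Num.Theory.
Import numFieldNormedType.Exports.

Local Open Scope classical_set_scope.
Local Open Scope ring_scope.

(* The points of R^n are the row vectors 'rV[R]_n.  The library provides their
   topology and differential calculus but neither a sigma-algebra nor a
   measure; both are built here.  The sigma-algebra is the one generated by the
   coordinate maps, i.e. the Borel sigma-algebra of R^n. *)

Definition rV_display : measure_display -> measure_display.
Proof. exact. Qed.

Section measurable_rV.
Context {R : realType}.
Variable n : nat.

Definition rV_coord (i : 'I_n) (x : 'rV[R]_n) : measurableTypeR R := x ord0 i.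

Let rV_set0 : g_sigma_preimage rV_coord set0.
Proof. exact: sigma_algebra0. Qed.

Let rV_setC A : g_sigma_preimage rV_coord A -> g_sigma_preimage rV_coord (~` A).
Proof. exact: sigma_algebraC. Qed.

Let rV_bigcup (F : (set 'rV[R]_n)^nat) :
  (forall i, g_sigma_preimage rV_coord (F i)) ->
  g_sigma_preimage rV_coord (\bigcup_i (F i)).
Proof. exact: sigma_algebra_bigcup. Qed.

HB.instance Definition _ := @isMeasurable.Build (rV_display default_measure_display)
  'rV[R]_n (g_sigma_preimage rV_coord) rV_set0 rV_setC rV_bigcup.

End measurable_rV.

Section measurable_rV_theory.
Context {R : realType}.

Lemma measurable_rV_coord n (i : 'I_n) :
  measurable_fun [set: 'rV[R]_n] (rV_coord i).
Proof.
move=> _ Y mY; rewrite setTI; apply: sub_sigma_algebra => /=.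
rewrite -bigcup_seq/=; exists i => /=; first by rewrite mem_index_enum.
by exists Y => //; rewrite setTI.
Qed.

Lemma measurable_fun_rV d (T : measurableType d) n (f : T -> 'rV[R]_n) :
  (forall i, measurable_fun [set: T] (rV_coord i \o f)) ->
  measurable_fun [set: T] f.
Proof.
move=> mf _ A mA; rewrite setTI.
have : <<s preimage_set_system setT f
   (\big[setU/set0]_(i < n) preimage_set_system setT (rV_coord i) measurable) >>
   (f @^-1` A).
  rewrite g_sigma_preimageE.
  by exists A => //; rewrite setTI.
apply: smallest_sub; first exact: sigma_algebra_measurable.
move=> _ [B + <-]; rewrite setTI -bigcup_seq => -[i _ [C mC <-]].
rewrite setTI.
have := mf i measurableT _ mC.
by rewrite setTI.
Qed.

Definition cons_rV n (xy : measurableTypeR R * 'rV[R]_n) : 'rV[R]_n.+1 :=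
  row_mx (xy.1%:M : 'rV[R]_1) xy.2.

Lemma cons_rV0 n xy : @cons_rV n xy ord0 ord0 = xy.1.
Proof.
rewrite /cons_rV (_ : ord0 = lshift n (ord0 : 'I_1)); last exact/val_inj.
by rewrite (@row_mxEl _ 1 1 n) mxE eqxx.
Qed.

Lemma cons_rVS n xy i : @cons_rV n xy ord0 (lift ord0 i) = xy.2 ord0 i.
Proof.
rewrite /cons_rV (_ : lift ord0 i = rshift 1 i); last exact/val_inj.
by rewrite (@row_mxEr _ 1 1 n).
Qed.

Lemma measurable_cons_rV n : measurable_fun setT (@cons_rV n).
Proof.
apply: measurable_fun_rV => i; have [j ->|->] := unliftP ord0 i; last first.
  rewrite (_ : _ \o _ = fst); first exact: measurable_fst.
  by apply/funext => xy /=; rewrite /rV_coord cons_rV0.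
rewrite (_ : _ \o _ = rV_coord j \o snd).
  by apply: measurableT_comp; [exact: measurable_rV_coord|exact: measurable_snd].
by apply/funext => xy /=; rewrite /rV_coord cons_rVS.
Qed.

Definition uncons_rV n (x : 'rV[R]_n.+1) : measurableTypeR R * 'rV[R]_n :=
  (x ord0 ord0, \row_j x ord0 (lift ord0 j)).

Lemma cons_rVK n : cancel (@cons_rV n) (@uncons_rV n).
Proof.
move=> [x y]; rewrite /uncons_rV cons_rV0; congr pair.
by apply/rowP => j; rewrite mxE cons_rVS.
Qed.

Lemma uncons_rVK n : cancel (@uncons_rV n) (@cons_rV n).
Proof.
move=> x; apply/rowP => i; have [j ->|->] := unliftP ord0 i.
  by rewrite cons_rVS mxE.
by rewrite cons_rV0.
Qed.

Lemma measurable_uncons_rV n : measurable_fun setT (@uncons_rV n).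
Proof.
apply: measurable_fun_pair; first exact: (measurable_rV_coord ord0).
apply: measurable_fun_rV => i.
rewrite (_ : _ \o _ = rV_coord (lift ord0 i)); first exact: measurable_rV_coord.
by apply/funext => x /=; rewrite /rV_coord mxE.
Qed.

End measurable_rV_theory.


Section lebesgue_rV.
Context {R : realType}.
Local Open Scope ereal_scope.

Section cons_measure.
Variables (n : nat) (m : {sigma_finite_measure set 'rV[R]_n -> \bar R}).

Definition cons_measure : set 'rV[R]_n.+1 -> \bar R :=
  pushforward (lebesgue_measure \x m) (@cons_rV R n).

Let cons_measure0 : cons_measure set0 = 0.
Proof. by rewrite /cons_measure /pushforward preimage_set0 measure0. Qed.

Let cons_measure_ge0 A : 0 <= cons_measure A.
Proof. by rewrite /cons_measure /pushforward; exact: measure_ge0. Qed.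

Let cons_measure_sigma_additive : semi_sigma_additive cons_measure.
Proof.
move=> F mF tF mUF; rewrite /cons_measure /pushforward preimage_bigcup.
have mcons k : measurable (@cons_rV R n @^-1` F k).
  by rewrite -[X in measurable X]setTI; exact: measurable_cons_rV.
apply: measure_semi_sigma_additive => //.
- apply/trivIsetP => /= i j _ _ ij; rewrite -preimage_setI.
  by move/trivIsetP : tF => /(_ _ _ _ _ ij) ->//; rewrite preimage_set0.
- exact: bigcupT_measurable.
Qed.

HB.instance Definition _ := isMeasure.Build _ _ _ cons_measure
  cons_measure0 cons_measure_ge0 cons_measure_sigma_additive.

Let cons_measure_sigma_finite : sigma_finite setT cons_measure.
Proof.
have /sigma_finiteP[F [TF ndF Foo]] := sigma_finiteT (@lebesgue_measure R).
have /sigma_finiteP[G [TG ndG Goo]] := sigma_finiteT m.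
exists (fun k => @uncons_rV R n @^-1` (F k `*` G k)).
  rewrite -preimage_bigcup [X in _ @^-1` X](_ : _ = setT) ?preimage_setT//.
  rewrite -subTset => -[x y] _.
  have [i _ Fix] : (\bigcup_i F i) x by rewrite -TF.
  have [j _ Gjy] : (\bigcup_i G i) y by rewrite -TG.
  exists (maxn i j) => //; split.
  - by move: x Fix; exact/subsetPset/ndF/leq_maxl.
  - by move: y Gjy; exact/subsetPset/ndG/leq_maxr.
move=> k; have [mF Fkoo] := Foo k; have [mG Gkoo] := Goo k.
have mFG : measurable (F k `*` G k) by exact: measurableX.
split; first by rewrite -[X in measurable X]setTI; exact: measurable_uncons_rV.
rewrite /cons_measure /pushforward -comp_preimage.
rewrite (_ : _ \o _ = id) ?preimage_id; last exact/funext/cons_rVK.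
by rewrite product_measure1E// lte_mul_pinfty// ge0_fin_numE.
Qed.

HB.instance Definition _ := Measure_isSigmaFinite.Build _ _ _ cons_measure
  cons_measure_sigma_finite.

End cons_measure.

Fixpoint lebesgue_rV n : {sigma_finite_measure set 'rV[R]_n -> \bar R} :=
  if n is n'.+1 then cons_measure (lebesgue_rV n') else dirac (0%R : 'rV[R]_0).

Lemma lebesgue_rV_box n (a b : 'rV[R]_n) :
  (forall i, a ord0 i <= b ord0 i)%R ->
  lebesgue_rV n [set x : 'rV[R]_n | forall i, x ord0 i \in `[a ord0 i, b ord0 i]] =
  (\prod_(i < n) (b ord0 i - a ord0 i))%:E.
Proof.
elim: n a b => [|n ih] a b ab /=.
  by rewrite diracE big_ord0 mem_set// => -[].
pose B : set 'rV[R]_n := [set x : 'rV[R]_n | forall i, x ord0 i \in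
  `[(uncons_rV a).2 ord0 i, (uncons_rV b).2 ord0 i]].
have mB : measurable B.
  have -> : B = \bigcap_(i in [set: 'I_n])
      ((@rV_coord R n i) @^-1` `[(uncons_rV a).2 ord0 i, (uncons_rV b).2 ord0 i]).
    by apply/seteqP; split => [x Bx i _|x Bx i]; [exact: Bx|exact: (Bx i I)].
  apply: fin_bigcap_measurable => // i _.
  rewrite -[X in measurable X]setTI.
  by apply: measurable_rV_coord => //; exact: measurable_itv.
rewrite /cons_measure /pushforward.
set A := (X in (_ \x _) X).
have -> : A = [set` `[a ord0 ord0, b ord0 ord0]] `*` B.
  apply/seteqP; split => [xy Axy|xy [x0 xS] i].
    split => [|i] /=; first by have := Axy ord0; rewrite cons_rV0.
    by have := Axy (lift ord0 i); rewrite cons_rVS !mxE.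
  have [j ->|->] := unliftP ord0 i; last by rewrite cons_rV0.
  by have := xS j; rewrite /uncons_rV /= cons_rVS !mxE.
have mI : measurable ([set` `[a ord0 ord0, b ord0 ord0]] : set (measurableTypeR R)).
  exact: measurable_itv.
rewrite product_measure1E//.
rewrite ih => [|i]; last by rewrite !mxE.
rewrite big_ord_recl EFinM; under eq_bigr do rewrite !mxE.
congr (_ * _).
transitivity (@lebesgue_measure R `[a ord0 ord0, b ord0 ord0]%classic) => //.
rewrite lebesgue_measure_itv/= lte_fin.
by have := ab ord0; rewrite le_eqVlt => /predU1P[->|->]; rewrite ?ltxx ?subrr.
Qed.

End lebesgue_rV.

Section weights.
Context {R : realType}.
Variable n : nat.
Implicit Types (p q l : R) (a : 'rV[R]_n) (Q : set 'rV[R]_n).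
Implicit Types (w f : 'rV[R]_n -> R) (g : 'rV[R]_n -> \bar R).
Local Open Scope ereal_scope.

Local Notation mu := (lebesgue_rV n : {measure set 'rV[R]_n -> \bar R}).

Definition is_weight w : Prop :=
  [/\ measurable_fun [set: 'rV[R]_n] w,
      (forall x, 0 <= w x)%R &
      0 < mu [set x | (0 < w x)%R]].

Definition cube a l : set 'rV[R]_n :=
  [set x : 'rV[R]_n | forall i, x ord0 i \in `[a ord0 i, (a ord0 i + l)%R]].

Definition average Q g : \bar R := (\int[mu]_(x in Q) g x) / mu Q.

Definition conj_exp p : R := (p / (p - 1))%R.

(* w^{-r}.  The real power 0 `^ (- r) is 0 for r != 0, whereas w^{-r} must be
   +oo where w vanishes: hence the inverse is the one of \bar R. *)
Definition inv_power w (r : R) : 'rV[R]_n -> \bar R :=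
  fun x => (w x `^ r)%:E^-1.

(* For p = 1 the second factor is the essential supremum of w^{-q} over Q;
   extending w^{-q} by 0 outside Q does not affect it since w^{-q} >= 0. *)
Definition Apq_term p q w Q : \bar R :=
  average Q (fun x => (w x `^ q)%:E) *
  (if p == 1%R then ess_sup mu (inv_power w q \_ Q)
   else average Q (inv_power w (conj_exp p)) `^ (q / conj_exp p)).

Definition Apq_const p q w : \bar R :=
  ereal_sup [set Apq_term p q w (cube al.1 al.2) |
             al in [set al : 'rV[R]_n * R | (0 < al.2)%R]].

Definition Apq p q w : Prop := is_weight w /\ Apq_const p q w < +oo.

Definition weighted_norm p w f : \bar R :=
  (\int[mu]_x (`|f x| `^ p * w x)%:E) `^ p^-1.

Definition grad f (x : 'rV[R]_n) : 'rV[R]_n :=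
  \row_i 'D_(delta_mx ord0 i) f x.

(* The library norm on 'rV[R]_n is the sup norm. *)
Definition euclidean_norm (v : 'rV[R]_n) : R :=
  Num.sqrt (\sum_i v ord0 i ^+ 2)%R.

Definition C1 f : Prop :=
  (forall x, differentiable f x) /\ continuous (grad f).

(* The weighted Sobolev inequality with constant c and exponent alpha.  Without
   f \in L^q(w^q) it fails for the nonzero constant functions, whatever alpha;
   no decay or compact support is required beyond that. *)
Definition weighted_sobolev p q (alpha c : R) : Prop :=
  forall w f, Apq p q w -> C1 f ->
    weighted_norm q (fun x => w x `^ q)%R f < +oo ->
    weighted_norm q (fun x => w x `^ q)%R f <=
    c%:E * Apq_const p q w `^ alpha *
      weighted_norm p (fun x => w x `^ p)%R (euclidean_norm \o grad f).

End weights.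

(* Main.v *)
Require Import Defs.
From mathcomp Require Import all_boot all_order all_algebra.
From mathcomp Require Import all_classical all_reals all_analysis ess_sup_inf.
From mathcomp Require Import measurable_realfun ring lra.

(** The exponent is tested on the power weights w with w^q = |x|^(s - n) and
    on the functions f(x) = (1 + |x|_2^2)^(- s), for 0 < s <= 1 and s -> 0.
    Here |x| is the sup norm, chosen because its balls are cubes, whose measure
    is explicit; |x|_2 is the Euclidean norm, which makes f smooth.

    The weight w^q is almost non-integrable at the origin: its integral over
    the unit ball is of order 1/s, since each of the dyadic shells
    |x| ~ 2^(-k) with k < 1/s contributes an amount of order one.  The negative
    powers of w are positive powers of |x|, hence bounded by their value at the
    largest |x| in the cube.  So the A_{p,q} constant is at most C / s
    ([Apq_const_power_weight_le]).

    On the unit ball f is bounded below, so ||f||_{L^q(w^q)} >= c s^(-1/q)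
    ([weighted_norm_slow_decay_ge]).  On the other hand f varies slowly:
    |grad f| <= 2 s (1 + |x|_2^2)^(- s - 1/2).  By the relation
    1/p - 1/q = 1/n, the function |x|^(-p) w^p is |x|^(-n) up to a power of
    |x| of order s, so that |grad f|^p w^p is s^p times a function whose
    integral over the unit ball is bounded and whose integral over the rest of
    the space is of order 1/s.  Hence ||grad f||_{L^p(w^p)} <= C s^(1 - 1/p)
    ([weighted_norm_grad_slow_decay_le]).

    The quotient of the two norms is thus at least of order
    s^(- (1/q + 1 - 1/p)) = s^(- (1 - 1/n)) = (1/s)^(1/n'), so an exponent
    alpha < 1/n' of the A_{p,q} constant cannot compensate for it.  When alpha
    is negative, the upper bound on the constant says nothing about its power
    alpha; there one uses that the constant is at least 2^(-n)
    ([Apq_const_power_weight_ge]).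

    All integrals of powers of |x| are compared with series of indicator
    functions of nested balls of dyadic radii ([le_integral_nested_balls]). *)

Import Order.TTheory GRing.Theory Num.Theory.
Import numFieldNormedType.Exports.

Local Open Scope classical_set_scope.
Local Open Scope ring_scope.

(** * Real powers and dyadic scales *)

Section real_powers.
Context {R : realType}.
Implicit Types x y e s S : R.

Lemma powR_mono {y x e} : 0 <= y -> y <= x -> 0 <= e -> y `^ e <= x `^ e.
Proof.
move=> y0 yx e0; apply: ge0_ler_powR => //; rewrite nnegrE//.
exact: le_trans yx.
Qed.

Lemma powR_anti {y x e} : 0 < y -> y <= x -> e <= 0 -> x `^ e <= y `^ e.
Proof.
move=> y0 yx e0; rewrite -[e]opprK !(powRN _ (- e)).
have x0 := lt_le_trans y0 yx.
by rewrite lef_pV2 ?posrE ?powR_gt0// powR_mono ?oppr_ge0// ltW.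
Qed.

Lemma powRDp {x e s} : 0 < x -> x `^ (e + s) = x `^ e * x `^ s.
Proof. by move=> x0; apply: powRD; rewrite (gt_eqF x0) implybT. Qed.

Lemma powRDn {x} e (m : nat) : 0 < x -> x `^ (e - m%:R) * x ^+ m = x `^ e.
Proof. by move=> x0; rewrite -(powR_mulrn _ (ltW x0)) -powRDp// subrK. Qed.

(** The index is the least one for which the left inequality holds. *)
Lemma dyadic_shell x S : 0 < x -> x <= S ->
  exists k, S / 2 ^+ k.+1 < x /\ x <= S / 2 ^+ k.
Proof.
move=> x0 xS; have S0 := lt_le_trans x0 xS.
have ex : exists k, S / 2 ^+ k.+1 < x.
  exists (Num.trunc (S / x)); rewrite ltr_pdivrMr ?exprn_gt0// mulrC -ltr_pdivrMr//.
  apply: lt_trans (truncnS_gt _) _.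
  by rewrite -natrX ltr_nat ltn_expl.
exists (ex_minn ex); case: ex_minnP => -[|k] Sx mk; split => //.
  by rewrite expr0 divr1.
by rewrite leNgt; apply/negP => /mk; rewrite ltnn.
Qed.

(** The dyadic series below have ratio 2^(- s); this is what turns their sums
    into bounds of order 1/s.  It comes from 2^s >= 1 + s ln 2 and
    ln 2 >= 1/2. *)
Lemma geometric_ratio_bound s : 0 < s -> s <= 1 -> (1 - 2 `^ (- s))^-1 <= 4 / s.
Proof.
move=> s0 s1; have p0 : 0 < (2 : R) `^ s by rewrite powR_gt0.
have ln2 : 1 / 2 <= ln (2 : R).
  have h : -1 < (2^-1 - 1 : R) by lra.
  have := le_ln1Dx h; rewrite (_ : 1 + _ = 2^-1); last by ring.
  by rewrite lnV ?posrE//; lra.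
have : 1 + s / 2 <= (2 : R) `^ s.
  rewrite /powR pnatr_eq0/=; apply: le_trans (expR_ge1Dx _).
  by rewrite lerD2l; apply: ler_wpM2l; lra.
have : (2 : R) `^ s <= 2.
  rewrite -[leRHS]powRr1//; apply: ler_powR => //; lra.
rewrite powRN; set b := 2 `^ s => b2 bs.
have sb : s / 4 <= 1 - b^-1.
  have -> : 1 - b^-1 = (b - 1) / b by rewrite mulrBl divff ?mul1r// gt_eqF.
  rewrite ler_pdivlMr//; nra.
by rewrite -[4 / s]invf_div lef_pV2// posrE; [apply: lt_le_trans sb|]; rewrite divr_gt0.
Qed.

Lemma powR2N_lt1 s : 0 < s -> 2 `^ (- s) < 1 :> R.
Proof.
move=> s0; rewrite powRN invf_lt1 ?powR_gt0// -[ltLHS](powRr0 2).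
by rewrite /powR pnatr_eq0/= ltr_expR mul0r mulr_gt0// ln_gt0// ltr1n.
Qed.

End real_powers.

(** * Cubes and balls of the sup norm *)

Section cubes.
Context {R : realType} {n : nat}.
Local Notation mu := (lebesgue_rV n : {measure set 'rV[R]_n -> \bar R}).

Lemma le_sup_normP (x : 'rV[R]_n) (r : R) : 0 <= r ->
  reflect (forall i, `|x ord0 i| <= r) (`|x| <= r).
Proof.
move=> r0; rewrite {2}/Num.Def.normr/= mx_normrE.
apply: (iffP (bigmax_leP _ _ _ _)) => [[_ xr] i|xr]; first exact: (xr (ord0, i)).
by split => // -[i j] _; rewrite ord1; exact: xr.
Qed.

Lemma measurable_cube (a : 'rV[R]_n) (l : R) : measurable (cube a l).
Proof.
have -> : cube a l = \bigcap_(i in [set: 'I_n])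
    ((@rV_coord R n i) @^-1` `[a ord0 i, a ord0 i + l]).
  by apply/seteqP; split => [x ax i _|x ax i]; [exact: ax|exact: (ax i I)].
apply: fin_bigcap_measurable => // i _.
rewrite -[X in measurable X]setTI.
by apply: measurable_rV_coord => //; exact: measurable_itv.
Qed.

Lemma lebesgue_cube (a : 'rV[R]_n) (l : R) : 0 <= l -> mu (cube a l) = (l ^+ n)%:E.
Proof.
move=> l0; have := @lebesgue_rV_box R n a (\row_i (a ord0 i + l)).
set B := (X in lebesgue_rV n X) => H.
have -> : cube a l = B.
  by apply/seteqP; split => x /= ax i; have := ax i; rewrite !mxE.
rewrite [LHS]H => [|i]; last by rewrite mxE lerDl.
congr EFin; rewrite (eq_bigr (fun=> l)) => [|i _]; last by rewrite mxE addrC addKr.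
by rewrite prodr_const card_ord.
Qed.

Definition sup_ball (r : R) : set 'rV[R]_n := [set x | `|x| <= r].

Lemma sup_ballE r : 0 <= r -> sup_ball r = cube (const_mx (- r)) (r *+ 2).
Proof.
move=> r0; apply/seteqP; split => x /= => [/(le_sup_normP _ _ r0) xr i|xr].
  by have := xr i; rewrite mxE in_itv/= mulr2n addKr ler_norml.
apply/(le_sup_normP _ _ r0) => i.
by have := xr i; rewrite mxE in_itv/= mulr2n addKr ler_norml.
Qed.

Lemma measurable_sup_ball r : measurable (sup_ball r).
Proof.
have [r0|r0] := leP 0 r; first by rewrite sup_ballE//; exact: measurable_cube.
rewrite (_ : sup_ball r = set0)//; apply/seteqP; split => // x /= xr.
by have := le_lt_trans xr r0; rewrite ltNge normr_ge0.
Qed.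

Lemma lebesgue_sup_ball r : 0 <= r -> mu (sup_ball r) = ((r *+ 2) ^+ n)%:E.
Proof. by move=> r0; rewrite sup_ballE// lebesgue_cube// mulrn_wge0. Qed.

Lemma measurable_sup_norm (D : set 'rV[R]_n) :
  measurable_fun D (fun x : 'rV[R]_n => `|x| : measurableTypeR R).
Proof.
apply: (measurable_funS measurableT (subsetT _)).
apply: (measurability _ (RGenOInfty.measurableE R)) => _ [_ [r ->] <-].
rewrite setTI (_ : _ @^-1` _ = ~` sup_ball r).
  by apply: measurableC; exact: measurable_sup_ball.
apply/seteqP; split => x /=; rewrite in_itv/= andbT ltNge; first by move=> /negP.
by move=> /negP.
Qed.

End cubes.

(** * Integrals of powers of the sup norm *)

Section radial_integrals.
Context {R : realType} {n : nat}.
Local Notation mu := (lebesgue_rV n : {measure set 'rV[R]_n -> \bar R}).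
Implicit Types (D : set 'rV[R]_n) (g : 'rV[R]_n -> R) (s : R).

Lemma integral_sup_ball_cst D (r c : R) : measurable D -> 0 <= r -> 0 <= c ->
  (\int[mu]_(x in D) (c * \1_(sup_ball r) x)%:E <= (c * (r *+ 2) ^+ n)%:E)%E.
Proof.
move=> mD r0 c0; under eq_integral do rewrite EFinM.
have mB := @measurable_sup_ball R n r.
rewrite ge0_integralZl//; last first.
- by apply/measurable_EFinP; exact: measurable_indic.
rewrite integral_indic// EFinM lee_wpmul2l ?lee_fin//.
rewrite -(lebesgue_sup_ball r r0).
by apply: le_measure; rewrite ?inE//; exact: measurableI.
Qed.

(** A point x at which g is at most a_k, for some k with |x| <= r_k, satisfies
    g(x) <= \sum_k a_k 1_{|x| <= r_k}.  Integrating this series term by term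
    needs only the measure of balls, not that of shells. *)
Lemma le_integral_nested_balls D g (r a : nat -> R) (M b : R) :
  measurable D -> measurable_fun D g -> (forall x, D x -> 0 <= g x) ->
  (forall k, 0 <= r k) -> (forall k, 0 <= a k) -> 0 <= M -> 0 < b -> b < 1 ->
  (forall x, D x -> exists k, `|x| <= r k /\ g x <= a k) ->
  (forall k, a k * (r k *+ 2) ^+ n <= M * b ^+ k) ->
  (\int[mu]_(x in D) (g x)%:E <= (M / (1 - b))%:E)%E.
Proof.
move=> mD mg g0 r0 a0 M0 b0 b1 gra aM.
pose F k (x : 'rV[R]_n) : \bar R := (a k * \1_(sup_ball (r k)) x)%:E.
have F0 k x : (0 <= F k x)%E by rewrite lee_fin mulr_ge0.
have mF k : measurable_fun D (F k).
  apply/measurable_EFinP; apply: measurable_funM => //.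
  by apply: measurable_indic; exact: measurable_sup_ball.
apply: (@le_trans _ _ (\int[mu]_(x in D) \sum_(0 <= k <oo) F k x)%E).
  apply: ge0_le_integral => //.
  - exact/measurable_EFinP.
  - exact: ge0_emeasurable_sum.
  move=> x Dx; have [k [xr ga]] := gra x Dx.
  apply: (@le_trans _ _ (F k x)).
    by rewrite /F indicE mem_set// mulr1 lee_fin.
  apply: (le_trans _ (@nneseries_lim_ge _ _ predT 0 k.+1 _)) => //.
  by rewrite big_nat_recr//= leeDr// sume_ge0.
rewrite integral_nneseries//.
apply: lime_le; first by apply: is_cvg_nneseries => k _ _; exact: integral_ge0.
apply: nearW => N; rewrite big_mkord.
apply: (@le_trans _ _ (\sum_(k < N) (M * b ^+ k)%:E)%E).
  apply: lee_sum => k _; apply: le_trans (integral_sup_ball_cst _ _ _ _ _ _) _ => //.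
  by rewrite lee_fin.
rewrite sumEFin lee_fin.
have := @geometric_le_lim R N M b M0 b0; rewrite (ger0_norm (ltW b0)) => /(_ b1).
by rewrite /series/= big_mkord.
Qed.


Let originE : [set 0] = sup_ball 0 :> set 'rV[R]_n.
Proof. by apply/seteqP; split => x; rewrite /sup_ball/= normr_le0 => /eqP. Qed.

Lemma measurable_origin : measurable [set (0 : 'rV[R]_n)].
Proof. by rewrite originE; exact: measurable_sup_ball. Qed.

Lemma lebesgue_origin : (0 < n)%N -> mu [set 0] = 0%E.
Proof. by move=> n0; rewrite originE lebesgue_sup_ball// mul0rn expr0n eqn0Ngt n0. Qed.

Lemma measurable_norm_powR D e :
  measurable_fun D (fun x : 'rV[R]_n => `|x| `^ e : measurableTypeR R).
Proof.
apply: (measurableT_comp (measurable_powR e)).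
exact: measurable_sup_norm.
Qed.

(** The value of the power at radius y, times the measure of the ball of radius
    2 y: on the shell y <= |x| <= 2 y a decreasing power is largest at y. *)
Lemma ball_shell_term (s y : R) : 0 < y ->
  y `^ (s - n%:R) * ((y *+ 2) *+ 2) ^+ n = 4 ^+ n * y `^ s.
Proof.
move=> y0; rewrite -mulrnA -[y *+ _]mulr_natl exprMn mulrCA -[RHS]mulrC.
by rewrite powRDn// mulrC.
Qed.

(** The ball of radius S is covered by the balls of radius S / 2^k; outside the
    next one, the power is at most its value at radius S / 2^(k+1).  The
    strict inequality s < n makes the power vanish at the origin, where
    0 `^ e = 0 for e != 0. *)
Lemma le_integral_norm_powR_ball s S : 0 < s -> s <= 1 -> s < n%:R -> 0 < S ->
  (\int[mu]_(x in sup_ball S) (`|x| `^ (s - n%:R))%:E <=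
   (4 ^+ n * S `^ s * (4 / s))%:E)%E.
Proof.
move=> s0 s1 sn S0.
have ratio := geometric_ratio_bound _ s0 s1.
have b0 : 0 < (2 : R) `^ (- s) by rewrite powR_gt0.
have b1 := powR2N_lt1 _ s0.
have r0 k : 0 < S / 2 ^+ k by rewrite divr_gt0// exprn_gt0.
apply: (@le_trans _ _ (4 ^+ n * S `^ s / (1 - 2 `^ (- s)))%:E); last first.
  by rewrite lee_fin ler_wpM2l// mulr_ge0 ?powR_ge0.
apply: (@le_integral_nested_balls _ _ (fun k => S / 2 ^+ k)
  (fun k => (S / 2 ^+ k.+1) `^ (s - n%:R))) => //.
- exact: measurable_sup_ball.
- exact: measurable_norm_powR.
- by move=> k; exact/ltW.
- by move=> k; exact: powR_ge0.
- by rewrite mulr_ge0 ?powR_ge0.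
- move=> x xS; have [->|x0] := eqVneq x 0.
    exists 0%N; rewrite normr0 powR0 ?powR_ge0//; last by rewrite subr_eq0 lt_eqF.
    by split => //; exact: ltW.
  have [|k [k1 k2]] := dyadic_shell _ _ _ xS; first by rewrite normr_gt0.
  exists k; split => //; apply: powR_anti => //; first exact: ltW.
  by rewrite subr_le0 ltW.
- move=> k; have -> : S / 2 ^+ k = (S / 2 ^+ k.+1) *+ 2.
    by rewrite exprS -mulr_natr; field; rewrite expf_neq0.
  rewrite ball_shell_term// -mulrA ler_wpM2l//.
  rewrite powRM ?(ltW S0) ?invr_ge0// ler_wpM2l ?powR_ge0//.
  rewrite -powR_invn// -powRrM -powR_mulrn ?powR_ge0// -powRrM ler_powR// ?ler1n//.
  by rewrite -[k.+1]addn1 natrD; nra.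
Qed.

Lemma measurable_sup_out : measurable [set x : 'rV[R]_n | 1 <= `|x|].
Proof.
rewrite (_ : [set _ | _] = setT `&` (fun x : 'rV[R]_n => `|x|) @^-1` `[1, +oo[%classic).
  by apply: (measurable_sup_norm setT) => //; exact: measurable_itv.
by rewrite setTI; apply/seteqP; split => x /=; rewrite in_itv/= andbT.
Qed.

(** The same comparison with balls of increasing radii 2^k, where k is the least
    index such that |x| <= 2^k. *)
Lemma le_integral_norm_powR_out s : 0 < s -> s <= 1 ->
  (\int[mu]_(x in [set x : 'rV[R]_n | (1 <= `|x|)%R]) (`|x| `^ (- n%:R - s))%:E <=
   (4 ^+ n * 2 * (4 / s))%:E)%E.
Proof.
move=> s0 s1.
have ratio := geometric_ratio_bound _ s0 s1.
have b0 : 0 < (2 : R) `^ (- s) by rewrite powR_gt0.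
have b1 := powR2N_lt1 _ s0.
apply: (@le_trans _ _ (4 ^+ n * 2 / (1 - 2 `^ (- s)))%:E); last first.
  by rewrite lee_fin ler_wpM2l// mulr_ge0.
have r0 k : 0 < (2 : R) ^+ k / 2 by rewrite divr_gt0// exprn_gt0.
apply: (@le_integral_nested_balls _ _ (fun k => 2 ^+ k)
  (fun k => (2 ^+ k / 2) `^ (- n%:R - s))) => //.
- exact: measurable_sup_out.
- exact: measurable_norm_powR.
- move=> x /= x1.
  have ex : exists k, `|x| <= 2 ^+ k.
    exists (Num.trunc `|x|).+1; apply/ltW/(lt_trans (truncnS_gt _)).
    by rewrite -natrX ltr_nat ltn_expl.
  exists (ex_minn ex); case: ex_minnP => k xk mk; split => //.
  apply: powR_anti => //; last by rewrite -opprD oppr_le0 addr_ge0// ltW.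
  case: k xk mk => [_ _|k _ mk]; first by rewrite expr0; lra.
  rewrite exprSr mulfK// leNgt; apply/negP => /ltW /mk.
  by rewrite ltnn.
- move=> k; rewrite [X in _ * (X *+ 2) ^+ _](_ : _ = (2 ^+ k / 2) *+ 2 :> R); last first.
    by rewrite -[RHS]mulr_natr divfK.
  rewrite [- n%:R - s]addrC ball_shell_term// -mulrA ler_wpM2l//.
  rewrite powRM ?invr_ge0// -[2^-1](@powR_inv1 _ 2)// -powRrM mulrNN mul1r.
  rewrite mulrC ler_pM ?powR_ge0//.
    by rewrite -[leRHS]powRr1//; apply: ler_powR; rewrite ?ler1n.
  rewrite -!powR_mulrn ?powR_ge0// -!powRrM ler_powR ?ler1n//; nra.
Qed.

(** The indicators of the balls of radius 2^(-k), weighted by 2^(k (n - s)), add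
    up to at most twice the power, because the weights at least double at each
    step (this uses s <= n - 1).  Each term with k s <= 1 has integral bounded
    below, and there are about 1/s of them. *)
Lemma ge_integral_norm_powR_unit_ball s : (0 < n)%N -> 0 < s -> s <= 1 -> s <= n%:R - 1 ->
  ((4 * s)^-1%:E <= \int[mu]_(x in sup_ball 1) (`|x| `^ (s - n%:R))%:E)%E.
Proof.
move=> n0 s0 s1 sn.
pose r k : R := 2^-1 ^+ k.
pose a k : R := 2 `^ (n%:R - s) ^+ k.
pose N := (Num.trunc s^-1).+1.
have a2 : 2 <= 2 `^ (n%:R - s) :> R.
  by rewrite -[leLHS]powRr1//; apply: ler_powR; [rewrite ler1n|lra].
have a0 k : 0 <= a k by rewrite exprn_ge0// powR_ge0.
have r0 k : 0 <= r k by rewrite exprn_ge0.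
pose F k (x : 'rV[R]_n) : \bar R := (2^-1 * a k * \1_(sup_ball (r k)) x)%:E.
have mB k := @measurable_sup_ball R n (r k).
have F0 k x : (0 <= F k x)%E by rewrite lee_fin !mulr_ge0.
have mF k D : measurable_fun D (F k).
  apply/measurable_EFinP; apply: measurable_funM => //.
have ind1 k (x : 'rV[R]_n) : \1_(sup_ball (r k)) x <= 1 :> R.
  by rewrite indicE; case: (_ \in _).
have pt (x : 'rV[R]_n) m : x != 0 ->
    \sum_(k < m) a k * \1_(sup_ball (r k)) x <= 2 * `|x| `^ (s - n%:R).
  move=> x0; elim: m => [|m ih]; first by rewrite big_ord0 mulr_ge0 ?powR_ge0.
  rewrite big_ord_recr/=.
  have [xm|xm] := leP `|x| (r m); last first.
    by rewrite indicE memNset ?mulr0 ?addr0//= => /(lt_le_trans xm); rewrite ltxx.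
  apply: (@le_trans _ _ (2 * a m)).
    apply: (@le_trans _ _ (\sum_(k < m.+1) a k)).
      rewrite big_ord_recr/=; apply: lerD; last by rewrite ler_piMr.
      by apply: ler_sum => k _; rewrite ler_piMr.
    elim: (m) => [|j jh]; first by rewrite big_ord1/=; have := a0 0%N; lra.
    rewrite big_ord_recr/=; apply: le_trans (lerD jh (lexx _)) _.
    by rewrite {2 3}/a exprS -/(a j); have := a0 j; nra.
  rewrite ler_wpM2l//.
  apply: (@le_trans _ _ (r m `^ (s - n%:R))); last first.
    by apply: powR_anti => //; [rewrite normr_gt0|lra].
  rewrite /a /r exprVn -powR_invn// -powRrM -powR_mulrn ?powR_ge0// -powRrM.
  by rewrite (_ : _ * _ = - m%:R * (s - n%:R)) //; ring.
apply: (@le_trans _ _ (\int[mu]_(x in sup_ball 1) \sum_(k < N) F k x)%E).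
  rewrite ge0_integral_sum//; last exact: measurable_sup_ball.
  have Fk k : (k < N)%N -> (4^-1%:E <= \int[mu]_(x in sup_ball 1) F k x)%E.
    move=> kN; under eq_integral do rewrite /F EFinM.
    rewrite ge0_integralZl//; last 3 first.
    - exact: measurable_sup_ball.
    - by apply/measurable_EFinP; exact: measurable_indic.
    - by rewrite lee_fin mulr_ge0.
    rewrite integral_indic//; last exact: measurable_sup_ball.
    rewrite setIidl; last first.
      rewrite /sup_ball => x /le_trans; apply.
      by rewrite /r exprn_ile1 ?invr_ge0// invf_le1// ler1n.
    rewrite lebesgue_sup_ball// -EFinM lee_fin -mulrA.
    have -> : a k * (r k *+ 2) ^+ n = 2 `^ (- s *+ k) * 2 ^+ n.
      rewrite -[r k *+ 2]mulr_natr exprMn mulrA; congr (_ * _).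
      rewrite /a /r -exprM mulnC exprM -exprMn exprVn mulrC -powR_invn//.
      by rewrite -powRDp// addrA addNr add0r -powR_mulrn ?powR_ge0// -powRrM mulr_natr.
    have p2 : 2 <= (2 : R) ^+ n by rewrite -[leLHS]expr1 ler_weXn2l ?ler1n.
    have : 2^-1 <= (2 : R) `^ (- s *+ k).
      rewrite -[leLHS]powR_inv1// ler_powR ?ler1n// mulNrn lerN2.
      have : k%:R <= s^-1 by rewrite -truncn_ge_nat ?invr_ge0 ?ltW.
      by rewrite -[s^-1]mul1r ler_pdivlMr// mulr_natl.
    nra.
  apply: (@le_trans _ _ (\sum_(k < N) 4^-1%:E)%E); last by apply: lee_sum => k _; exact: Fk.
  rewrite sumEFin sumr_const card_ord lee_fin invfM -[_ *+ N]mulr_natr ler_wpM2l//.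
  exact/ltW/truncnS_gt.
apply: ae_ge0_le_integral => //.
- exact: measurable_sup_ball.
- by move=> x _; rewrite sume_ge0.
- exact: emeasurable_sum.
- apply/measurable_EFinP; exact: measurable_norm_powR.
- exists [set 0]; split; [exact: measurable_origin|exact: lebesgue_origin|].
  move=> x /= xx; apply/eqP/negP => /negP x0; apply: xx => _.
  rewrite /F sumEFin lee_fin -(ler_pM2l (ltr0Sn R 1)) (le_trans _ (pt x N x0))//.
  rewrite mulr_sumr; apply: ler_sum => k _; lra.
Qed.

End radial_integrals.

(** * Averages over cubes *)

Section averages.
Context {R : realType} {n : nat}.
Local Notation mu := (lebesgue_rV n : {measure set 'rV[R]_n -> \bar R}).
Implicit Types (a : 'rV[R]_n) (l c : R) (g : 'rV[R]_n -> \bar R).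

Lemma average_cubeE a l g : 0 < l ->
  average (cube a l) g = ((\int[mu]_(x in cube a l) g x) * (l ^- n)%:E)%E.
Proof.
move=> l0; rewrite /average; congr (_ * _)%E.
transitivity (mu (cube a l))^-1%E; first by [].
rewrite lebesgue_cube ?ltW// inver gt_eqF// exprn_gt0//.
Qed.

Lemma average_cube_ge0 a l g : 0 < l -> (forall x, 0 <= g x)%E ->
  (0 <= average (cube a l) g)%E.
Proof.
move=> l0 g0; rewrite average_cubeE//; apply: mule_ge0; first exact: integral_ge0.
by rewrite lee_fin invr_ge0 exprn_ge0// ltW.
Qed.

Lemma average_cube_le_int a l g c : 0 < l ->
  (\int[mu]_(x in cube a l) g x <= (c * l ^+ n)%:E)%E ->
  (average (cube a l) g <= c%:E)%E.
Proof.
move=> l0 gc; rewrite average_cubeE//.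
apply: (le_trans (lee_wpmul2r _ gc)).
  by rewrite lee_fin invr_ge0 exprn_ge0// ltW.
by rewrite -EFinM mulfK// gt_eqF// exprn_gt0.
Qed.

Lemma average_cube_le a l g c : 0 < l -> 0 <= c ->
  measurable_fun (cube a l) g -> (forall x, 0 <= g x)%E ->
  {ae mu, forall x, cube a l x -> (g x <= c%:E)%E} ->
  (average (cube a l) g <= c%:E)%E.
Proof.
move=> l0 c0 mg g0 gc; apply: average_cube_le_int => //.
rewrite EFinM -(lebesgue_cube a l (ltW l0)) -integral_cst; last exact: measurable_cube.
by apply: ae_ge0_le_integral => //; exact: measurable_cube.
Qed.

Lemma average_cube_ge a l g c : 0 < l -> 0 <= c ->
  measurable_fun (cube a l) g -> (forall x, cube a l x -> (c%:E <= g x)%E) ->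
  (c%:E <= average (cube a l) g)%E.
Proof.
move=> l0 c0 mg gc; rewrite average_cubeE//.
have -> : c%:E = ((c * l ^+ n)%:E * (l ^- n)%:E)%E.
  by rewrite -EFinM mulfK// gt_eqF// exprn_gt0.
apply: lee_wpmul2r; first by rewrite lee_fin invr_ge0 exprn_ge0// ltW.
rewrite EFinM -(lebesgue_cube a l (ltW l0)) -integral_cst; last exact: measurable_cube.
by apply: ge0_le_integral => //; exact: measurable_cube.
Qed.

End averages.

(** * Power weights and their Muckenhoupt constant *)

Section power_weight.
Context {R : realType} {n : nat}.
Local Notation mu := (lebesgue_rV n : {measure set 'rV[R]_n -> \bar R}).
Implicit Types (s p q : R).

(** The power is normalized so that w^q = |x|^(s - n). *)
Definition power_weight q s (x : 'rV[R]_n) : R := `|x| `^ ((s - n%:R) / q).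

Lemma power_weight_powR q s r x :
  power_weight q s x `^ r = `|x| `^ ((s - n%:R) * (r / q)).
Proof. by rewrite /power_weight -powRrM mulrAC mulrA. Qed.

Lemma inv_power_weight q s r x : x != 0 ->
  inv_power (power_weight q s) r x = (`|x| `^ ((n%:R - s) * (r / q)))%:E.
Proof.
move=> x0; rewrite /inv_power power_weight_powR inver gt_eqF ?powR_gt0 ?normr_gt0//.
by rewrite -powRN -mulNr opprB.
Qed.

Lemma measurable_inv_power (w : 'rV[R]_n -> R) r D :
  measurable_fun [set: 'rV[R]_n] w -> measurable_fun D (inv_power w r).
Proof.
move=> mw; apply: (measurable_funS measurableT (subsetT _)).
have mwr := measurableT_comp (measurable_powR r) mw.
rewrite (_ : inv_power w r =
    fun x => if w x `^ r == 0 then +oo%E else (w x `^ (- r))%:E); last first.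
  by apply/funext => x; rewrite /inv_power inver powRN.
apply: measurable_fun_ifT => //.
  apply: (measurable_fun_eqr mwr); exact: measurable_cst.
by apply/measurable_EFinP; exact: (measurableT_comp (measurable_powR (- r)) mw).
Qed.

Lemma inv_power_ge0 (w : 'rV[R]_n -> R) r x : (0 <= inv_power w r x)%E.
Proof. by rewrite /inv_power inve_ge0 lee_fin powR_ge0. Qed.

Lemma is_weight_power_weight q s : (0 < n)%N -> is_weight (power_weight q s).
Proof.
move=> n0; split.
- exact: measurable_norm_powR.
- by move=> x; exact: powR_ge0.
pose Q := cube (const_mx 1 : 'rV[R]_n) 1.
apply: (@lt_le_trans _ _ (mu Q)).
  by rewrite lebesgue_cube// lte_fin exprn_gt0.
have mQ : measurable Q by exact: measurable_cube.
apply: le_measure; rewrite ?inE//.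
  rewrite (_ : [set _ | _] = setT `&` power_weight q s @^-1` `]0, +oo[%classic).
    by apply: measurable_norm_powR => //; exact: measurable_itv.
  by rewrite setTI; apply/seteqP; split => x /=; rewrite in_itv/= andbT.
move=> x Qx /=; rewrite powR_gt0// normr_gt0; apply/eqP => x0.
have := Qx (Ordinal n0); rewrite x0 !mxE in_itv/=; lra.
Qed.

End power_weight.

Section Apq_power_weight.
Context {R : realType} {n : nat}.
Hypothesis n0 : (0 < n)%N.
Local Notation mu := (lebesgue_rV n : {measure set 'rV[R]_n -> \bar R}).
Implicit Types (a : 'rV[R]_n) (s p q l : R).

(** A cube either stays at distance S / 2 from the origin, S being
    the largest |x| in the cube, or has a side of length at least S / 2.  The
    radius is attained at one of the two extreme corners of the cube. *)
Lemma cube_radius a l : 0 < l ->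
  exists S : R, [/\ 0 < S, forall x, cube a l x -> `|x| <= S &
    forall x, cube a l x -> `|x| < S / 2 -> S / 2 <= l].
Proof.
move=> l0; pose b : 'rV[R]_n := a + const_mx l.
have dist x y : cube a l x -> cube a l y -> `|x| <= `|y| + l.
  move=> Qx Qy; apply/le_sup_normP; first by rewrite addr_ge0// ltW.
  move=> i; have /le_sup_normP-/(_ (normr_ge0 y) i) := lexx `|y|.
  have := Qx i; have := Qy i; rewrite !in_itv/= !ler_norml.
  move=> /andP[? ?] /andP[? ?] /andP[? ?]; apply/andP; split; lra.
have Qa : cube a l a by move=> i; rewrite in_itv/= lexx/= lerDl ltW.
have Qb : cube a l b by move=> i; rewrite in_itv/= !mxE lexx andbT lerDl ltW.
have xS x : cube a l x -> `|x| <= Num.max `|a| `|b|.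
  move=> Qx; apply/le_sup_normP; first by rewrite le_max normr_ge0.
  move=> i; have := Qx i; rewrite in_itv/= => /andP[ax xb].
  have /le_sup_normP-/(_ (normr_ge0 a) i) := lexx `|a|.
  have /le_sup_normP-/(_ (normr_ge0 b) i) := lexx `|b|.
  rewrite !mxE le_max !ler_norml => /andP[? ?] /andP[? ?].
  have [x0|x0] := leP 0 (x ord0 i); apply/orP; [right|left]; apply/andP; split; lra.
exists (Num.max `|a| `|b|); split => //.
  rewrite lt_max !normr_gt0 -negb_and; apply/negP => /andP[/eqP a0 /eqP].
  move=> /rowP/(_ (Ordinal n0)); rewrite /b a0 !mxE; lra.
move=> x Qx; have := dist _ _ Qa Qx; have := dist _ _ Qb Qx.
by have [_|_] := leP `|a| `|b|; lra.
Qed.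

(** When the cube comes closer than S / 2 to the origin, its side is comparable
    to S and the integral over the ball of radius S bounds the average;
    otherwise |x|^(s - n) is comparable to S^(s - n) on the whole cube. *)
Lemma average_norm_powR_le a l s S : 0 < s -> s <= 1 -> s < n%:R -> 0 < l ->
  0 < S -> (forall x, cube a l x -> `|x| <= S) ->
  (forall x, cube a l x -> `|x| < S / 2 -> S / 2 <= l) ->
  (average (cube a l) (fun x => (`|x| `^ (s - n%:R))%:E) <=
   (8 ^+ n * (4 / s) * S `^ (s - n%:R))%:E)%E.
Proof.
move=> s0 s1 sn l0 S0 QS Ql.
have S20 : 0 < S / 2 by rewrite divr_gt0.
have S2E : (S / 2) `^ (s - n%:R) <= 2 ^+ n * S `^ (s - n%:R).
  rewrite powRM ?(ltW S0)// mulrC ler_wpM2r ?powR_ge0//.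
  rewrite -powR_inv1// -powRrM -powR_mulrn// ler_powR ?ler1n//; lra.
have M0 : 1 <= 4 / s by rewrite ler_pdivlMr// mul1r; lra.
have [near0|away] := pselect (exists2 x, cube a l x & `|x| < S / 2).
  have lS : S / 2 <= l by case: near0 => x Qx; exact: Ql.
  apply: average_cube_le_int => //.
  apply: (@le_trans _ _ (\int[mu]_(x in sup_ball S) (`|x| `^ (s - n%:R))%:E)%E).
    apply: ge0_subset_integral => //.
    - exact: measurable_cube.
    - exact: measurable_sup_ball.
    - by apply/measurable_EFinP; exact: measurable_norm_powR.
  apply: (le_trans (le_integral_norm_powR_ball _ _ s0 s1 sn S0)).
  rewrite lee_fin -(powRDn s n S0).
  have -> : 8 ^+ n = 4 ^+ n * 2 ^+ n :> R by rewrite -exprMn; congr (_ ^+ _); ring.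
  have Sl : S ^+ n <= 2 ^+ n * l ^+ n.
    by rewrite -exprMn; apply: lerXn2r; rewrite ?nnegrE; lra.
  have := @powR_ge0 R S (s - n%:R); move: (S `^ _) => v v0.
  have -> : 4 ^+ n * (v * S ^+ n) * (4 / s) = (4 ^+ n * (4 / s) * v) * S ^+ n by ring.
  have -> : 4 ^+ n * 2 ^+ n * (4 / s) * v * l ^+ n =
            (4 ^+ n * (4 / s) * v) * (2 ^+ n * l ^+ n) by ring.
  by rewrite ler_wpM2l// !mulr_ge0//; lra.
apply: average_cube_le => //.
- by rewrite !mulr_ge0 ?powR_ge0//; lra.
- by apply/measurable_EFinP; exact: measurable_norm_powR.
apply: aeW => x Qx; rewrite lee_fin.
have Sx : S / 2 <= `|x| by rewrite leNgt; apply/negP => xS; apply: away; exists x.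
apply: le_trans (powR_anti S20 Sx _) _; first by rewrite subr_le0 ltW.
apply: (le_trans S2E); rewrite ler_wpM2r ?powR_ge0//.
have : 2 ^+ n <= 8 ^+ n :> R by rewrite lerXn2r ?nnegrE//; lra.
have : 0 <= 2 ^+ n :> R by [].
nra.
Qed.

Lemma ae_neq0 : {ae mu, forall x : 'rV[R]_n, x != 0}.
Proof.
exists [set 0]; split; [exact: measurable_origin|exact: lebesgue_origin|].
by move=> x /= /negP; rewrite negbK => /eqP.
Qed.

Lemma conj_exp_gt0 p : 1 < p -> 0 < conj_exp p.
Proof. by move=> p1; rewrite /conj_exp divr_gt0//; lra. Qed.

(** A cube has positive measure, so a bound that holds at all of its points
    cannot be lost on a null set. *)
Lemma measure_cube_ess_sup_ge a l (g : 'rV[R]_n -> \bar R) (c : \bar R) : 0 < l ->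
  (forall x, cube a l x -> (c <= g x)%E) -> (c <= ess_sup mu (g \_ (cube a l)))%E.
Proof.
move=> l0 cg; rewrite leNgt; apply/negP => gc.
have [N [mN muN0 QN]] := ess_sup_ge mu (g \_ (cube a l)).
have : (mu (cube a l) <= mu N)%E.
  apply: le_measure; rewrite ?inE//; first exact: measurable_cube.
  move=> x Qx; apply: QN => /=; apply/negP; rewrite -ltNge.
  by rewrite patchE mem_set// (lt_le_trans gc)// cg.
by rewrite muN0 lebesgue_cube ?(ltW l0)// lee_fin leNgt exprn_gt0.
Qed.

(** The first factor is at most C / s * S^(s - n) and the second one at most
    S^(n - s), whether it is an average or an essential supremum.  The origin,
    at which the negative powers of w are infinite, is a null set. *)
Lemma Apq_power_weight_le p q s a l : 1 <= p -> 0 < q -> 0 < s -> s <= 1 -> s < n%:R ->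
  0 < l -> (Apq_term p q (power_weight q s) (cube a l) <= (8 ^+ n * (4 / s))%:E)%E.
Proof.
move=> p1 q0 s0 s1 sn l0.
have [S [S0 QS Ql]] := cube_radius a l l0.
have Sns : 0 <= S `^ (n%:R - s) by exact: powR_ge0.
have base r x : 0 <= r -> x != 0 -> cube a l x ->
    (inv_power (power_weight q s) r x <= (S `^ ((n%:R - s) * (r / q)))%:E)%E.
  move=> r0 x0 Qx; rewrite inv_power_weight// lee_fin powR_mono ?QS//.
  by rewrite mulr_ge0 ?divr_ge0 ?subr_ge0// ltW.
apply: (@le_trans _ _
  ((8 ^+ n * (4 / s) * S `^ (s - n%:R))%:E * (S `^ (n%:R - s))%:E)%E); last first.
  rewrite -EFinM lee_fin -(mulrA (8 ^+ n * (4 / s))) -powRDp//.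
  by rewrite addrA subrK subrr powRr0 mulr1.
rewrite /Apq_term; apply: lee_pmul.
- by apply: average_cube_ge0 => // x; rewrite lee_fin powR_ge0.
- case: ifP => [_|_]; last exact: poweR_ge0.
  by apply: measure_cube_ess_sup_ge => // x _; exact: inv_power_ge0.
- under [X in average _ X]funext do rewrite power_weight_powR divff ?gt_eqF// mulr1.
  exact: average_norm_powR_le.
case: ifPn => [_|p1']; first apply/ess_supP.
  apply: filterS ae_neq0 => x x0; rewrite patchE; case: ifPn => [|_]; last by rewrite lee_fin.
  rewrite inE => Qx; apply: le_trans (base q x _ x0 Qx) _ => //; first exact: ltW.
  by rewrite divff ?mulr1// gt_eqF.
have pp : 1 < p by rewrite lt_neqAle eq_sym p1'.
have c0 := conj_exp_gt0 p pp.
have h : (average (cube a l) (inv_power (power_weight q s) (conj_exp p)) <=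
    (S `^ ((n%:R - s) * (conj_exp p / q)))%:E)%E.
  apply: average_cube_le => //.
  - exact: powR_ge0.
  - by apply: measurable_inv_power; exact: measurable_norm_powR.
  - by move=> x; exact: inv_power_ge0.
  - by apply: filterS ae_neq0 => x x0 Qx; apply: base => //; exact: ltW.
apply: (@le_trans _ _ ((S `^ ((n%:R - s) * (conj_exp p / q)))%:E `^ (q / conj_exp p))%E).
  apply: gt0_ler_poweR => //; first by rewrite divr_ge0// ltW.
  - rewrite in_itv/= leey andbT; apply: average_cube_ge0 => // x.
    exact: inv_power_ge0.
  - by rewrite in_itv/= leey andbT lee_fin powR_ge0.
rewrite poweR_EFin -powRrM lee_fin.
rewrite (_ : _ * _ * _ = n%:R - s)//; field.
by rewrite !gt_eqF.
Qed.

Lemma Apq_const_power_weight_le p q s : 1 <= p -> 0 < q -> 0 < s -> s <= 1 -> s < n%:R ->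
  (Apq_const p q (power_weight q s : 'rV[R]_n -> R) <= (8 ^+ n * (4 / s))%:E)%E.
Proof.
move=> p1 q0 s0 s1 sn; apply: ge_ereal_sup => _ [[a l] /= l0 <-].
exact: Apq_power_weight_le.
Qed.

(** Evaluated on the cube with 1 <= x_i <= 2, where 1 <= |x| <= 2. *)
Lemma Apq_const_power_weight_ge p q s : 1 <= p -> 0 < q -> 0 < s -> s < n%:R ->
  ((2 ^- n)%:E <= Apq_const p q (power_weight q s : 'rV[R]_n -> R))%E.
Proof.
move=> p1 q0 s0 sn.
pose a : 'rV[R]_n := const_mx 1.
apply: ereal_sup_ge; exists (Apq_term p q (power_weight q s) (cube a 1)).
  by exists (a, 1) => /=.
have Q1 x : cube a 1 x -> 1 <= `|x| /\ `|x| <= 2.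
  move=> Qx; split.
    have /le_sup_normP-/(_ (normr_ge0 x) (Ordinal n0)) := lexx `|x|.
    apply: le_trans; have := Qx (Ordinal n0); rewrite in_itv/= mxE => /andP[x1 _].
    by apply: le_trans x1 _; exact: ler_norm.
  apply/le_sup_normP => // i; have := Qx i; rewrite in_itv/= mxE ler_norml => /andP[? ?].
  by apply/andP; split; lra.
have x0 x : cube a 1 x -> x != 0.
  by move=> /Q1[x1 _]; rewrite -normr_gt0; lra.
have base r x : 0 <= r -> cube a 1 x -> (1%:E <= inv_power (power_weight q s) r x)%E.
  move=> r0 Qx; rewrite inv_power_weight ?x0// lee_fin.
  have [x1 _] := Q1 x Qx.
  apply: (@le_trans _ _ (1 `^ ((n%:R - s) * (r / q)))); first by rewrite powR1.
  apply: powR_mono => //.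
  by rewrite mulr_ge0 ?divr_ge0 ?subr_ge0// ltW.
rewrite -[leLHS]mule1 /Apq_term; apply: lee_pmul => //.
- apply: average_cube_ge => //.
    apply/measurable_EFinP.
    apply: (measurableT_comp (measurable_powR q)); exact: measurable_norm_powR.
  move=> x Qx; rewrite lee_fin power_weight_powR divff ?gt_eqF// mulr1.
  have [x1 x2] := Q1 x Qx.
  apply: le_trans (powR_anti _ x2 _); rewrite ?subr_le0 ?(ltW sn)//; last by rewrite normr_gt0 x0.
  by rewrite -powR_invn// ler_powR ?ler1n//; lra.
case: ifPn => [_|p1'].
  apply: measure_cube_ess_sup_ge => // x Qx; apply: base => //; exact: ltW.
have pp : 1 < p by rewrite lt_neqAle eq_sym p1'.
have c0 := conj_exp_gt0 p pp.
rewrite -[leLHS](poweR1r (q / conj_exp p)).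
have h : (1%:E <= average (cube a 1) (inv_power (power_weight q s) (conj_exp p)))%E.
  apply: average_cube_ge => //.
    by apply: measurable_inv_power; exact: measurable_norm_powR.
  by move=> x Qx; apply: base => //; exact: ltW.
apply: gt0_ler_poweR => //; first by rewrite divr_ge0// ltW.
  by rewrite in_itv/= leey andbT.
by rewrite in_itv/= leey andbT (le_trans _ h).
Qed.

End Apq_power_weight.

(** * The slowly decaying test functions *)

Section bracket_power.
Context {R : realType} {n : nat}.
Implicit Types (x v : 'rV[R]_n) (e : R).

(** The square of the Japanese bracket of x. *)
Definition bracket x : R := 1 + \sum_i x ord0 i ^+ 2.

Lemma bracket_ge1 x : 1 <= bracket x.
Proof. by rewrite lerDl sumr_ge0// => i _; exact: sqr_ge0. Qed.

Lemma bracket_gt0 x : 0 < bracket x.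
Proof. exact: lt_le_trans (bracket_ge1 x). Qed.

Lemma is_derive_rV_coord x v (i : 'I_n) :
  is_derive x v (fun y : 'rV[R]_n => y ord0 i : R) (v ord0 i).
Proof.
have @f : {linear 'rV[R]_n -> R}.
  by exists (fun N : 'rV[R]_n => N ord0 i); do 2![eexists]; do ?[constructor];
     rewrite ?mxE// => ? *; rewrite ?mxE//; move=> ?; rewrite !mxE.
have -> : v ord0 i = f v by [].
rewrite (_ : (fun _ => _) = f)//.
have fc : continuous f by exact: coord_continuous.
have fd : differentiable f x by exact: linear_differentiable.
apply: DeriveDef; first exact: diff_derivable.
by rewrite deriveE// diff_lin.
Qed.

Lemma bracketE : bracket = cst 1 + \sum_(i < n) (fun x : 'rV[R]_n => x ord0 i : R) ^+ 2.
Proof.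
apply/funext => x; rewrite /bracket [in RHS]fctE; congr (_ + _).
by rewrite fct_sumE; apply: eq_bigr => i _; rewrite exprfctE.
Qed.

Lemma differentiable_bracket x : differentiable bracket x.
Proof.
rewrite bracketE; apply: differentiableD => //.
apply: differentiable_sum => i; apply: differentiableX.
exact: differentiable_coord.
Qed.

Lemma derive_bracket x v : 'D_v bracket x = \sum_(i < n) 2 * x ord0 i * v ord0 i.
Proof.
have d i := is_derive_rV_coord x v i.
rewrite bracketE.
have [_ ->] := is_deriveD (is_derive_cst (1 : R) x v) (is_derive_sum (fun i => is_deriveX 2 (d i))).
by rewrite add0r; apply: eq_bigr => i _; rewrite expr1.
Qed.

Lemma differentiable_bracket_powR e x : differentiable (fun y => bracket y `^ e) x.
Proof.
apply: (@differentiable_comp _ _ _ _ bracket (@powR R ^~ e)).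
  exact: differentiable_bracket.
apply/derivable1_diffP; apply: derivable_powR.
by rewrite in_itv/= andbT bracket_gt0.
Qed.

Lemma grad_bracket_powR e x :
  grad (fun y => bracket y `^ e) x = (2 * e * bracket x `^ (e - 1)) *: x.
Proof.
apply/rowP => i; rewrite !mxE deriveE; last exact: differentiable_bracket_powR.
rewrite (@diff_comp _ _ _ _ bracket (@powR R ^~ e)); first last.
- apply/derivable1_diffP; apply: derivable_powR.
  by rewrite in_itv/= andbT bracket_gt0.
- exact: differentiable_bracket.
rewrite /= diff1E; last first.
  apply/derivable1_diffP; apply: derivable_powR.
  by rewrite in_itv/= andbT bracket_gt0.
rewrite powR_derive1 ?in_itv/= ?andbT ?bracket_gt0//.
rewrite -deriveE; last exact: differentiable_bracket.
rewrite derive_bracket (bigD1 i)//= big1 ?addr0 => [|j ji].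
  by rewrite mxE !eqxx/= /GRing.scale/=; ring.
by rewrite mxE eqxx/= (negbTE ji) mulr0.
Qed.

Lemma C1_bracket_powR e : C1 (fun y : 'rV[R]_n => bracket y `^ e).
Proof.
split => [x|]; first exact: differentiable_bracket_powR.
rewrite (_ : grad _ = fun x => (2 * e * bracket x `^ (e - 1)) *: x); last first.
  by apply/funext => x; exact: grad_bracket_powR.
move=> x.
have h1 : {for x, continuous (fun y : 'rV[R]_n => bracket y `^ (e - 1))}.
  exact: (differentiable_continuous (differentiable_bracket_powR (e - 1) x)).
have h2 : {for x, continuous (fun y : 'rV[R]_n => 2 * e * bracket y `^ (e - 1))}.
  have h0 : {for x, continuous (fun _ : 'rV[R]_n => 2 * e : R)} by exact: cst_continuous.
  exact: (continuousM h0 h1).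
have h3 : {for x, continuous (@id 'rV[R]_n)} by exact: cvg_id.
exact: (continuousZ h2 h3).
Qed.

Lemma measurable_bracket D : measurable_fun D (bracket : 'rV[R]_n -> measurableTypeR R).
Proof.
apply: (measurable_funS measurableT (subsetT _)).
apply: measurable_funD => //; apply: measurable_sum => i.
by apply: measurable_funX; exact: measurable_rV_coord.
Qed.

(** Lets negative powers of the bracket be replaced by powers of the sup norm,
    in terms of which the integrals are estimated. *)
Lemma norm_sqr_le_bracket x : `|x| ^+ 2 <= bracket x.
Proof.
have b0 := ltW (bracket_gt0 x).
suff : `|x| <= Num.sqrt (bracket x).
  by rewrite -{2}(sqr_sqrtr b0) => h; rewrite lerXn2r ?nnegrE ?sqrtr_ge0.
apply/le_sup_normP => // i.
rewrite -(sqrtr_sqr (x ord0 i)) ler_sqrt// /bracket (bigD1 i)//=.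
rewrite addrCA lerDl addr_ge0// sumr_ge0// => j _; exact: sqr_ge0.
Qed.

Lemma bracket_le_unit_ball x : `|x| <= 1 -> bracket x <= 1 + n%:R.
Proof.
move=> x1; rewrite lerD2l -[n in leRHS]card_ord -sum1_card natr_sum ler_sum// => i _.
have /le_sup_normP-/(_ ler01 i) := x1.
by rewrite -(real_normK (num_real (x ord0 i))) => xi; rewrite expr_le1.
Qed.

Lemma euclidean_norm_le_bracket x : euclidean_norm x <= Num.sqrt (bracket x).
Proof. by rewrite ler_wsqrtr// lerDr. Qed.

Lemma euclidean_normZ (c : R) x : 0 <= c -> euclidean_norm (c *: x) = c * euclidean_norm x.
Proof.
move=> c0; rewrite /euclidean_norm.
under eq_bigr do rewrite mxE exprMn.
by rewrite -mulr_sumr sqrtrM ?sqr_ge0// sqrtr_sqr ger0_norm.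
Qed.

Lemma euclidean_normN x : euclidean_norm (- x) = euclidean_norm x.
Proof.
by rewrite /euclidean_norm; congr Num.sqrt; apply: eq_bigr => i _; rewrite mxE sqrrN.
Qed.

Lemma euclidean_norm_grad_bracket_powR e x : 0 <= e ->
  euclidean_norm (grad (fun y => bracket y `^ (- e)) x) =
  2 * e * bracket x `^ (- e - 1) * euclidean_norm x.
Proof.
move=> e0; rewrite grad_bracket_powR mulrN mulNr scaleNr euclidean_normN.
by rewrite euclidean_normZ// !mulr_ge0 ?powR_ge0.
Qed.

Lemma euclidean_norm_grad_bracket_powR_le e x : 0 <= e ->
  euclidean_norm (grad (fun y => bracket y `^ (- e)) x) <=
  2 * e * bracket x `^ (- e - 2^-1).
Proof.
move=> e0; rewrite euclidean_norm_grad_bracket_powR//.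
rewrite -!mulrA !ler_wpM2l//.
rewrite (_ : - e - 2^-1 = - e - 1 + 2^-1); last by field.
rewrite (@powRDp _ _ (- e - 1)) ?bracket_gt0// powR12_sqrt; last exact: ltW (bracket_gt0 x).
by rewrite ler_wpM2l ?powR_ge0// euclidean_norm_le_bracket.
Qed.

Lemma measurable_euclidean_norm D :
  measurable_fun D (@euclidean_norm R n : 'rV[R]_n -> measurableTypeR R).
Proof.
apply: (measurable_funS measurableT (subsetT _)).
have -> : @euclidean_norm R n = fun x => (\sum_i x ord0 i ^+ 2) `^ 2^-1.
  apply/funext => x; rewrite powR12_sqrt// sumr_ge0// => i _; exact: sqr_ge0.
apply: (measurableT_comp (measurable_powR _)); apply: measurable_sum => i.
by apply: measurable_funX; exact: measurable_rV_coord.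
Qed.

End bracket_power.

(** * The two sides of the inequality *)

Section norms.
Context {R : realType} {n : nat}.
Hypothesis n1 : (1 < n)%N.
Local Notation mu := (lebesgue_rV n : {measure set 'rV[R]_n -> \bar R}).
Implicit Types (s p q : R).

Let n0 : (0 < n)%N. Proof. exact: ltnW. Qed.
Let n2 : 2 <= n%:R :> R. Proof. by rewrite ler_nat. Qed.

(** Two different exponents are allowed because the weighted gradient is
    integrable at the origin uniformly in the parameter, unlike at infinity. *)
Lemma le_integral_in_out_powers (h : 'rV[R]_n -> R) (A s t : R) :
  0 <= A -> 0 < s -> s <= 1 -> 0 < t -> t <= 1 ->
  measurable_fun [set: 'rV[R]_n] h -> (forall x, 0 <= h x) ->
  (forall x, x != 0 -> `|x| <= 1 -> h x <= A * `|x| `^ (s - n%:R)) ->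
  (forall x, 1 <= `|x| -> h x <= A * `|x| `^ (- n%:R - t)) ->
  (\int[mu]_x (h x)%:E <= (A * (4 ^+ n * (4 / s + 8 / t)))%:E)%E.
Proof.
move=> A0 s0 s1 t0 t1 mh h0 hin hout.
have mB := @measurable_sup_ball R n 1.
have mC : measurable (~` sup_ball 1 : set 'rV[R]_n) by exact: measurableC.
have mEh (D : set 'rV[R]_n) : measurable_fun D (EFin \o h).
  by apply: (measurable_funS measurableT (subsetT _)); exact/measurable_EFinP.
have mpow (D : set 'rV[R]_n) e : measurable_fun D (fun x : 'rV[R]_n => (`|x| `^ e)%:E).
  by apply/measurable_EFinP; exact: measurable_norm_powR.
have mApow (D : set 'rV[R]_n) e :
    measurable_fun D (fun x : 'rV[R]_n => (A%:E * (`|x| `^ e)%:E)%E).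
  exact: measurable_funeM.
have s_n : s < n%:R by have := n2; lra.
rewrite -(setUv (sup_ball 1)) ge0_integral_setU//; last 2 first.
- by move=> x _; rewrite lee_fin.
- by apply/disj_setPS => x [].

have -> : A * (4 ^+ n * (4 / s + 8 / t)) =
    A * (4 ^+ n * 1 `^ s * (4 / s)) + A * (4 ^+ n * 2 * (4 / t)).
  by rewrite powR1; field; rewrite !gt_eqF.
rewrite EFinD; apply: leeD.
  rewrite EFinM; apply: le_trans (lee_wpmul2l _ (le_integral_norm_powR_ball _ _ s0 s1 s_n ltr01)).
    rewrite -ge0_integralZl ?lee_fin//.
    apply: ae_ge0_le_integral => //.
    - by move=> x _; rewrite lee_fin.
    - by move=> x _; rewrite mule_ge0// lee_fin.
    - apply: filterS (ae_neq0 n0) => x x0 x1.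
      by rewrite -EFinM lee_fin hin.
  by rewrite lee_fin.
rewrite EFinM; apply: le_trans (lee_wpmul2l _ (le_integral_norm_powR_out _ t0 t1)).
  rewrite -ge0_integralZl ?lee_fin//; last exact: measurable_sup_out.
  apply: (@le_trans _ _ (\int[mu]_(x in ~` sup_ball 1) (A%:E * (`|x| `^ (- n%:R - t))%:E))%E).
    apply: ge0_le_integral => //; first by move=> x _; rewrite lee_fin.
    by move=> x /negP; rewrite -ltNge => x1; rewrite -EFinM lee_fin hout// ltW.
  apply: ge0_subset_integral => //; first exact: measurable_sup_out.
    by move=> x _; rewrite mule_ge0.
  by move=> x /negP; rewrite -ltNge => /ltW.
by rewrite lee_fin.
Qed.

Definition slow_decay s (x : 'rV[R]_n) : R := bracket x `^ (- s).

Lemma powR_bracket_le_norm e (x : 'rV[R]_n) : e <= 0 -> x != 0 ->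
  (bracket x : R) `^ e <= (`|x| : R) `^ (2 * e).
Proof.
move=> e0 x0; rewrite powRrM powR_mulrn//.
apply: powR_anti => //; first by rewrite exprn_gt0// normr_gt0.
exact: norm_sqr_le_bracket.
Qed.

Lemma powR_bracket_le1 e (x : 'rV[R]_n) : e <= 0 -> bracket x `^ e <= 1.
Proof.
move=> e0; rewrite -[leRHS](powRr0 (bracket x)) ler_powR//; exact: bracket_ge1.
Qed.

Lemma slow_decay_weightE q s (x : 'rV[R]_n) :
  `|slow_decay s x| `^ q * power_weight q s x `^ q =
  bracket x `^ (- s * q) * `|x| `^ ((s - n%:R) * (q / q)).
Proof. by rewrite ger0_norm ?powR_ge0// power_weight_powR -powRrM. Qed.

Lemma measurable_bracket_norm_powR e d :
  measurable_fun [set: 'rV[R]_n] (fun x : 'rV[R]_n => bracket x `^ e * `|x| `^ d).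
Proof.
apply: measurable_funM; last exact: measurable_norm_powR.
by apply: (measurableT_comp (measurable_powR e)); exact: measurable_bracket.
Qed.

(** At infinity f^q w^q <= |x|^(- 2 s q + s - n), and - 2 s q + s <= - s because
    q >= 1. *)
Lemma weighted_norm_slow_decay_fin q s : 1 <= q -> 0 < s -> s <= 1 ->
  (weighted_norm q (fun x : 'rV[R]_n => power_weight q s x `^ q)%R (slow_decay s) < +oo)%E.
Proof.
move=> q1 s0 s1; apply: poweR_lty.
under eq_integral do rewrite slow_decay_weightE divff ?gt_eqF ?(lt_le_trans ltr01)// mulr1.
apply: le_lt_trans (le_integral_in_out_powers _ _ _ _ ler01 s0 s1 s0 s1 _ _ _ _) _.
- exact: measurable_bracket_norm_powR.
- by move=> x; rewrite mulr_ge0 ?powR_ge0.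
- move=> x x0 x1; rewrite ler_wpM2r ?powR_ge0// powR_bracket_le1//; nra.
- move=> x x1; have x0 : x != 0 by rewrite -normr_gt0; lra.
  rewrite mul1r; apply: (@le_trans _ _ (`|x| `^ (2 * (- s * q)) * `|x| `^ (s - n%:R))).
    by rewrite ler_wpM2r ?powR_ge0// powR_bracket_le_norm//; nra.
  rewrite -powRDp ?normr_gt0// ler_powR//; nra.
exact: ltry.
Qed.

(** On the unit ball the bracket is at most n + 1, so the integral is at least a
    constant times that of |x|^(s - n). *)
Lemma weighted_norm_slow_decay_ge q s : 1 <= q -> 0 < s -> s <= 1 ->
  (((4 * n.+1%:R)^-1 * s `^ (- q^-1))%:E <=
    weighted_norm q (fun x : 'rV[R]_n => power_weight q s x `^ q)%R (slow_decay s))%E.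
Proof.
move=> q1 s0 s1; have q0 : 0 < q by lra.
have N0 : 1 <= n.+1%:R :> R by rewrite ler1n.
have iq : 0 <= q^-1 by rewrite invr_ge0 ltW.
apply: (@le_trans _ _ ((n.+1%:R `^ (- q) * (4 * s)^-1)%:E `^ q^-1)%E).
  rewrite poweR_EFin lee_fin powRM ?powR_ge0//; last by rewrite invr_ge0 mulr_ge0// ltW.
  rewrite -powRrM mulNr divff ?gt_eqF// powR_inv1// invfM [leRHS]mulrC.
  rewrite [in leRHS]invfM powRM ?invr_ge0 ?(ltW s0)//.
  rewrite -[s^-1]powR_inv1 ?(ltW s0)// -powRrM mulN1r mulrAC.
  do 2!rewrite ler_wpM2r ?powR_ge0 ?invr_ge0//.
  rewrite -[leLHS]powRr1 ?invr_ge0//; apply: ger_powR; last by rewrite invf_le1.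
  by rewrite invr_gt0 invf_le1 ?ler1n ltr0n.
apply: gt0_ler_poweR => //.
- by rewrite in_itv/= leey andbT lee_fin mulr_ge0 ?powR_ge0// invr_ge0 mulr_ge0// ltW.
- rewrite in_itv/= leey andbT; apply: integral_ge0 => x _.
  by rewrite lee_fin mulr_ge0 ?powR_ge0.
under eq_integral do rewrite slow_decay_weightE divff ?gt_eqF// mulr1.
have mB := @measurable_sup_ball R n 1.
apply: (@le_trans _ _ (\int[mu]_(x in sup_ball 1)
    (bracket x `^ (- s * q) * `|x| `^ (s - n%:R))%:E)%E); last first.
  apply: ge0_subset_integral => //.
    by apply/measurable_EFinP; exact: measurable_bracket_norm_powR.
  by move=> x _; rewrite lee_fin mulr_ge0 ?powR_ge0.
have sn : s <= n%:R - 1 by have := n2; lra.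
rewrite EFinM.
apply: (le_trans (lee_wpmul2l _ (ge_integral_norm_powR_unit_ball _ n0 s0 s1 sn))).
  by rewrite lee_fin powR_ge0.
rewrite -ge0_integralZl//; last first.
- by apply/measurable_EFinP; exact: measurable_norm_powR.
apply: ge0_le_integral => //.
- by apply: measurable_funeM; apply/measurable_EFinP; exact: measurable_norm_powR.
- apply/measurable_EFinP; apply: (measurable_funS measurableT (subsetT _)).
  exact: measurable_bracket_norm_powR.
move=> x x1; rewrite -EFinM lee_fin ler_wpM2r ?powR_ge0//.
have b1 := bracket_ge1 x; have bn := bracket_le_unit_ball x x1.
apply: (@le_trans _ _ (bracket x `^ (- q))).
  by apply: powR_anti; rewrite ?bracket_gt0 -?nat1r// oppr_le0 ltW.
by rewrite ler_powR//; nra.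
Qed.

End norms.

(** Inside the unit ball the integrand is at most (2 s)^p |x|^(1 - n), whose
    integral does not involve 1/s; outside, it is at most
    (2 s)^p |x|^(- n - s). *)
Lemma weighted_norm_grad_slow_decay_le (R : realType) (n : nat) (p q s : R) :
  (1 < n)%N -> 1 <= p -> p^-1 - q^-1 = n%:R^-1 -> 1 <= q -> 0 < s -> s <= 1 ->
  (weighted_norm p (fun x : 'rV[R]_n => power_weight q s x `^ p)%R
     (@euclidean_norm R n \o grad (slow_decay s)) <=
   (24 * 4 ^+ n * s `^ (1 - p^-1))%:E)%E.
Proof.
move=> n1 p1 pq q1 s0 s1.
have n2 : 2 <= n%:R :> R by rewrite ler_nat.
have p0 : 0 < p by lra.
have q0 : 0 < q by lra.
have ip0 : 0 <= p^-1 by rewrite invr_ge0 ltW.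
have iq1 : q^-1 <= 1 by rewrite invf_le1.
have iq0 : 0 < q^-1 by rewrite invr_gt0.
have ip1 : p^-1 <= 1 by rewrite invf_le1.
(* The scaling relation cancels n between the weight and the gradient. *)
have expE : (s - n%:R) * (p / q) = p - n%:R + s * (p / q).
  have -> : p / q = 1 - p / n%:R.
    by rewrite -pq; field; rewrite !gt_eqF//; lra.
  by field; rewrite gt_eqF//; lra.
have pq0 : 0 <= p / q by rewrite divr_ge0// ltW.
have pqp : p / q <= p by rewrite ler_piMr// ltW.
have A0 : 0 <= (2 * s) `^ p by exact: powR_ge0.
have C12 : 1 <= 12 * 4 ^+ n :> R.
  have : 1 <= 4 ^+ n :> R by rewrite exprn_ege1//; lra.
  lra.
apply: (@le_trans _ _ (((2 * s) `^ p * (12 * 4 ^+ n / s))%:E `^ p^-1)%E); last first.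
  rewrite poweR_EFin lee_fin powRM ?powR_ge0//; last by rewrite divr_ge0; lra.
  rewrite -powRrM divff ?gt_eqF// powRr1; last by lra.
  rewrite powRM; [|lra|by rewrite invr_ge0 ltW].
  rewrite -[s^-1]powR_inv1 ?(ltW s0)// -powRrM mulN1r.
  rewrite powRDp// powRr1 ?(ltW s0)//.
  have : (12 * 4 ^+ n) `^ p^-1 <= 12 * 4 ^+ n :> R.
    by rewrite ler1_powR.
  have := @powR_ge0 R s (- p^-1); move: (s `^ _) (_ `^ p^-1) => v u v0 uC.
  have -> : 24 * 4 ^+ n * (s * v) = 2 * s * ((12 * 4 ^+ n) * v) by ring.
  by rewrite ler_wpM2l//; [lra|rewrite ler_wpM2r].
apply: gt0_ler_poweR => //.
- rewrite in_itv/= leey andbT; apply: integral_ge0 => x _.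
  by rewrite lee_fin mulr_ge0 ?powR_ge0.
- by rewrite in_itv/= leey andbT lee_fin mulr_ge0// divr_ge0; lra.
have En0 (x : 'rV[R]_n) : 0 <= euclidean_norm x by exact: sqrtr_ge0.
apply: (@le_trans _ _ ((2 * s) `^ p * (4 ^+ n * (4 / 1 + 8 / s)))%:E); last first.
  rewrite lee_fin ler_wpM2l// -mulrA mulrCA ler_wpM2l//.
  rewrite ler_pdivlMr// mulrDl divfK ?gt_eqF//; lra.
have pw (x : 'rV[R]_n) :
    `|(@euclidean_norm R n \o grad (slow_decay s)) x| `^ p * power_weight q s x `^ p <=
    (2 * s) `^ p * (bracket x `^ ((- s - 2^-1) * p) * `|x| `^ (p - n%:R + s * (p / q))).
  rewrite power_weight_powR expE [leRHS]mulrA ler_wpM2r ?powR_ge0//= ger0_norm//.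
  have h := euclidean_norm_grad_bracket_powR_le s x (ltW s0).
  apply: le_trans (powR_mono _ h (ltW p0)) _; first exact: En0.
  rewrite powRM ?powR_ge0//; last by lra.
  by rewrite -powRrM.
apply: le_integral_in_out_powers => //.
- apply: measurable_funM; last first.
    by apply: (measurableT_comp (measurable_powR p)); exact: measurable_norm_powR.
  apply: (measurableT_comp (measurable_powR p)).
  rewrite (_ : (fun x => `|_|) = fun x : 'rV[R]_n =>
      2 * s * bracket x `^ (- s - 1) * euclidean_norm x); last first.
    by apply/funext => x; rewrite /= ger0_norm// -euclidean_norm_grad_bracket_powR// ltW.
  apply: measurable_funM; last exact: measurable_euclidean_norm.
  apply: measurable_funM => //.
  by apply: (measurableT_comp (measurable_powR _)); exact: measurable_bracket.
- by move=> x; rewrite mulr_ge0 ?powR_ge0.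
- move=> x x0 x1; apply: le_trans (pw x) _; rewrite ler_wpM2l//.
  have h1 := powR_bracket_le1 ((- s - 2^-1) * p) x.
  have h2 : `|x| `^ (p - n%:R + s * (p / q)) <= `|x| `^ (1 - n%:R).
    apply: ger_powR; first by rewrite normr_gt0 x0.
    have : 0 <= s * (p / q) by rewrite mulr_ge0// ltW.
    lra.
  apply: le_trans h2; rewrite -[leRHS]mul1r ler_wpM2r ?powR_ge0// h1//; nra.
- move=> x x1; have x0 : x != 0 by rewrite -normr_gt0; lra.
  apply: le_trans (pw x) _; rewrite ler_wpM2l//.
  apply: (@le_trans _ _ (`|x| `^ (2 * ((- s - 2^-1) * p)) * `|x| `^ (p - n%:R + s * (p / q)))).
    by rewrite ler_wpM2r ?powR_ge0// powR_bracket_le_norm//; nra.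
  rewrite -powRDp ?normr_gt0// ler_powR//.
  have : s * (p / q) <= s * p by rewrite ler_wpM2l// ltW.
  nra.
Qed.

(** * Failure of smaller exponents *)

(** Bounds on A from both sides handle both signs of alpha: the upper one for
    alpha >= 0, the lower one for alpha < 0. *)
Lemma powR_le_between (R : realType) (alpha m M : R) : 0 < m ->
  exists2 K, 0 < K & forall s A : R, 0 < s -> m <= A -> A <= M / s ->
    A `^ alpha <= K * s `^ (- Num.max alpha 0).
Proof.
move=> m0; have [al0|al0] := ltP alpha 0.
  exists (m `^ alpha) => [|s A _ mA _]; first exact: powR_gt0.
  by rewrite oppr0 powRr0 mulr1 powR_anti// ltW.
exists (`|M| `^ alpha + 1) => [|s A s0 mA AM].
  by rewrite ltr_wpDl ?powR_ge0.
apply: (@le_trans _ _ ((`|M| / s) `^ alpha)).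
  apply: powR_mono => //; first by lra.
  by apply: (le_trans AM); rewrite ler_wpM2r ?invr_ge0 ?(ltW s0) ?ler_norm.
rewrite powRM ?invr_ge0 ?(ltW s0)// -[s^-1]powR_inv1 ?(ltW s0)// -powRrM mulN1r.
by rewrite ler_wpM2r ?powR_ge0// lerDl.
Qed.

Lemma powR_neg_unbounded (R : realType) (eps K : R) : 0 < eps ->
  exists s : R, [/\ 0 < s, s <= 1 & K < s `^ (- eps)].
Proof.
move=> eps0; have K1 : 1 <= `|K| + 1 by rewrite lerDr.
have K0 : 0 < `|K| + 1 by lra.
exists ((`|K| + 1) `^ (- eps^-1)); split; first exact: powR_gt0.
  rewrite -[leRHS](powRr0 (`|K| + 1)) ler_powR// oppr_le0 invr_ge0 ltW//.
rewrite -powRrM mulrNN mulVf ?gt_eqF// powRr1 ?(ltW K0)//.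
by rewrite (le_lt_trans (ler_norm K))// ltrDl.
Qed.

Theorem theorem1p7 (R : realType) (n : nat) (p q : R) :
  (1 < n)%N -> 1 <= p -> p < n%:R -> p^-1 - q^-1 = n%:R^-1 ->
  forall alpha : R, alpha < (conj_exp (n%:R : R))^-1 ->
    ~ exists c : R, 0 < c /\ weighted_sobolev n p q alpha c.
Proof.
move=> n1 p1 pn pq alpha alpha_n [c [c0 sob]].
have n2 : 2 <= n%:R :> R by rewrite ler_nat.
have n0 : (0 < n)%N by exact: ltnW.
have p0 : 0 < p by lra.
have ip1 : p^-1 <= 1 by rewrite invf_le1.
have in0 : 0 < n%:R^-1 :> R by rewrite invr_gt0; lra.
have q1 : 1 <= q.
  have iq0 : 0 < q^-1.
    have : n%:R^-1 < p^-1 by rewrite ltf_pV2 ?posrE//; lra.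
    by move: pq in0; lra.
  have q0 : 0 < q by rewrite -invr_gt0.
  by rewrite -[q]invrK invf_ge1//; lra.
have q0 : 0 < q by lra.
have conjE : (conj_exp (n%:R : R))^-1 = 1 - n%:R^-1.
  by rewrite /conj_exp; field; rewrite !gt_eqF//; lra.
have in1 : n%:R^-1 <= 2^-1 :> R by rewrite lef_pV2// posrE; lra.
(* The power alpha of the weight constant is O(s^(- beta)) for either sign. *)
pose beta := Num.max alpha 0.
have beta_n : beta < 1 - n%:R^-1.
  rewrite /beta gt_max -conjE alpha_n conjE; lra.
have m0 : 0 < 2 ^- n :> R by rewrite invr_gt0 exprn_gt0.
have [K K0 KA] := @powR_le_between R alpha (2 ^- n) (8 ^+ n * 4) m0.
pose C := 4 * n.+1%:R * (c * K * (24 * 4 ^+ n)).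
have [s [s0 s1 sC]] := @powR_neg_unbounded R (1 - n%:R^-1 - beta) C (ltac:(lra)).
have sn : s < n%:R by lra.
pose w := @power_weight R n q s.
have up := @Apq_const_power_weight_le R n n0 p q s p1 q0 s0 s1 sn.
have lo := @Apq_const_power_weight_ge R n n0 p q s p1 q0 s0 sn.
have wA : Apq p q w.
  split; first exact: is_weight_power_weight.
  by apply: le_lt_trans up _; exact: ltry.
have := sob w (slow_decay s) wA (C1_bracket_powR (- s)) (weighted_norm_slow_decay_fin n1 q s q1 s0 s1).
move/(le_trans (weighted_norm_slow_decay_ge n1 q s q1 s0 s1)).
have [A AE] : exists A : R, Apq_const p q w = A%:E.
  exists (fine (Apq_const p q w)); rewrite fineK// ge0_fin_numE; first by case: wA.
  by apply: le_trans lo; rewrite lee_fin.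
move: up lo; rewrite -/w AE !lee_fin => up lo.
have gr := @weighted_norm_grad_slow_decay_le R n p q s n1 p1 pq q1 s0 s1.
have cA : (0 <= c%:E * A%:E `^ alpha)%E.
  by rewrite poweR_EFin -EFinM lee_fin mulr_ge0 ?powR_ge0// ltW.
move/le_trans => /(_ _ (lee_wpmul2l cA gr)).
rewrite poweR_EFin -!EFinM lee_fin => main.
have AK : A `^ alpha <= K * s `^ (- beta) by apply: KA; rewrite // mulrA in up.
(* Both norms are now powers of s, and their exponents differ by
   1/q + 1 - 1/p = 1 - 1/n, up to beta. *)
have {main} : s `^ (- q^-1) <= C * s `^ (1 - p^-1 - beta).
  have N0 : 0 < 4 * n.+1%:R :> R by rewrite mulr_gt0.
  rewrite -(ler_pM2l (_ : 0 < (4 * n.+1%:R)^-1)) ?invr_gt0//.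
  apply: le_trans main _.
  rewrite /C -[4 * _ * _ * _]mulrA mulKf ?gt_eqF// [s `^ (1 - p^-1 - beta)]powRDp//.
  have := @powR_ge0 R s (1 - p^-1).
  move: (s `^ (1 - p^-1)) (s `^ (- beta)) (A `^ _) AK => v u a au v0.
  have -> : c * K * (24 * 4 ^+ n) * (v * u) = c * (K * u) * (24 * 4 ^+ n * v) by ring.
  rewrite ler_wpM2r ?mulr_ge0//.
  by rewrite ler_wpM2l// ltW.
apply/negP; rewrite -ltNge.
have -> : - q^-1 = - (1 - n%:R^-1 - beta) + (1 - p^-1 - beta) by rewrite -pq; ring.
by rewrite (@powRDp _ _ (- _))// ltr_pM2r// powR_gt0.
Qed.
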